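(* For every positive integer $t$, there is a hereditary weakly sparse class $\mathcal C_t$ of finite graphs of unbounded treewidth such that for every finite graph $H$ of treewidth at most $t$, the subclass $\{G \in \mathcal C_t : G \text{ is } H\text{-free}\}$ has bounded treewidth.
   Context: A graph $G$ is $H$-free if $H$ is not isomorphic to an induced subgraph of $G$. A class of graphs is hereditary if it is closed under taking induced subgraphs. A class is weakly sparse if there is a finite integer $s$ such that no graph of the class contains $K_{s,s}$ as a (not necessarily induced) subgraph. A class has bounded (resp. unbounded) treewidth if the treewidths of its members are (resp. are not) bounded by a constant. *)

(* Defs.v *)
From mathcomp Require Import all_boot.
Set Implicit Arguments. Unset Strict Implicit. Unset Printing Implicit Defensive.

Record sgraph := SGraph {
  vsize : nat;
  adj : rel 'I_vsize;
  adj_sym : symmetric adj;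
  adj_irr : irreflexive adj }.

Definition gclass := sgraph -> Prop.

Definition induced_sub (H G : sgraph) : Prop :=
  exists f : 'I_(vsize H) -> 'I_(vsize G),
    injective f /\ forall x y, @adj G (f x) (f y) = @adj H x y.

Definition H_free (H G : sgraph) : Prop := ~ induced_sub H G.

Definition hereditary (C : gclass) : Prop :=
  forall G H, C G -> induced_sub H G -> C H.

Definition contains_Kss (G : sgraph) (s : nat) : Prop :=
  exists A B : {set 'I_(vsize G)},
    [/\ #|A| = s, #|B| = s, [disjoint A & B] &
        forall a b, a \in A -> b \in B -> @adj G a b].

Definition weakly_sparse (C : gclass) : Prop :=
  exists s : nat, forall G, C G -> ~ contains_Kss G s.

Definition is_tree (m : nat) (T : rel 'I_m) : Prop :=
  [/\ 0 < m, symmetric T, irreflexive T,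
      (forall i j, connect T i j) &
      #|[set p : 'I_m * 'I_m | T p.1 p.2 && (val p.1 < val p.2)]| = m.-1].

Definition tw_le (G : sgraph) (k : nat) : Prop :=
  exists (m : nat) (T : rel 'I_m) (B : 'I_m -> {set 'I_(vsize G)}),
    [/\ is_tree T,
        (forall v, exists i, v \in B i),
        (forall u v, @adj G u v -> exists i, (u \in B i) && (v \in B i)),
        (forall v i j, v \in B i -> v \in B j ->
            connect [rel a b | [&& T a b, v \in B a & v \in B b]] i j) &
        (forall i, #|B i| <= k.+1)].

Definition bounded_tw (C : gclass) : Prop :=
  exists k : nat, forall G, C G -> tw_le G k.

(* Main.v *)
Require Import Defs.
From mathcomp Require Import all_boot.
From mathcomp Require Import zify.
Set Implicit Arguments. Unset Strict Implicit. Unset Printing Implicit Defensive.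

(* The class consists of the finite induced subgraphs of layered graphs. Layer k
   is a path on the words of length k over the alphabet {0, ..., N-1}, in
   lexicographic order. A letter carries a colour among t+1 and a set of colours;
   a word is joined, for each colour in the set of its last letter, to its nearest
   proper ancestor (prefix) of that colour. As each word has at most t+1 such
   neighbours, the graphs are weakly sparse, and the layers form a clique minor,
   so the treewidth is unbounded.

   Let S be the vertex set of an induced subgraph. If from every word some path
   of descendants to the last layer meets S at most b times, these cheap paths
   and the stored ancestors cut the graph into regions, which gives a tree
   decomposition of width O(b + t). Otherwise start from a word where all such
   paths meet S often and embed H of treewidth at most t greedily along an
   elimination order, coloured so that the earlier neighbours have distinct
   colours: repeating a prescribed letter must reach S, at the cost of at most
   one of the intersections, and keeps the stored ancestors of the other colours. *)

(** * Trees and tree decompositions *)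

Definition connected_in (I : finType) (T : rel I) (X : {set I}) :=
  {in X &, forall a b, connect [rel a b | [&& T a b, a \in X & b \in X]] a b}.

Definition minimal_in (I : finType) (d : I -> nat) (X : {set I}) (x : I) :=
  x \in X /\ {in X, forall y, d x <= d y}.

Lemma minimal_in_exists (I : finType) (d : I -> nat) (X : {set I}) :
  X != set0 -> exists x, minimal_in d X x.
Proof.
case/set0Pn=> x0 Xx0; exists [arg min_(x < x0 in X) d x].
by case: arg_minnP => // x Xx le_x; split.
Qed.

(** The length of a shortest path from [r] serves as [d]: the last edge of such a path comes from a
    vertex nearer to [r]. *)
Lemma exists_distance (m : nat) (T : rel 'I_m) (r : 'I_m) :
  (forall i, connect T r i) ->
  exists d : 'I_m -> nat, forall i, i != r -> exists j, T j i && (d j < d i).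
Proof.
move=> Tr; pose P i l := [exists p : l.-tuple 'I_m, path T r p && (last r p == i)].
have Pex i : exists l, P i l.
  have /connectP[p Tp def_i] := Tr i.
  exists (size p); apply/existsP; exists (in_tuple p).
  by rewrite Tp -def_i eqxx.
exists (fun i => ex_minn (Pex i)) => i ir.
case: (ex_minnP (Pex i)) => l /existsP[[p /= /eqP sz_p] /andP[Tp /eqP def_i]] _.
case/lastP: p => [|p x] in sz_p Tp def_i *; first by rewrite -def_i eqxx in ir.
rewrite last_rcons in def_i; subst x.
move: Tp; rewrite rcons_path => /andP[Tp Ti].
exists (last r p); rewrite Ti; case: ex_minnP => l' _ /(_ (size p)).
rewrite size_rcons in sz_p; rewrite -sz_p ltnS; apply.
by apply/existsP; exists (in_tuple p); rewrite Tp eqxx.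
Qed.

(* The [m.-1] edges towards a parent are pairwise distinct, so they are all the edges. *)
Lemma is_tree_rooted (m : nat) (T : rel 'I_m) : is_tree T ->
  exists (r : 'I_m) (par : 'I_m -> 'I_m) (d : 'I_m -> nat),
    (forall i, i != r -> d (par i) < d i) /\
    (forall i j, T i j -> (i != r) && (j == par i) || (j != r) && (i == par j)).
Proof.
case=> m_gt0 Tsym Tirr Tconn cardT; pose r := Ordinal m_gt0.
have [d dP] := exists_distance (Tconn r).
pose par i := odflt r [pick j | T j i && (d j < d i)].
have parP i : i != r -> T (par i) i && (d (par i) < d i).
  move=> ir; rewrite /par; case: pickP => //= none.
  by have [j] := dP i ir; rewrite none.
exists r, par, d; split=> [i /parP/andP[]//|i j Tij].
pose E := [set p : 'I_m * 'I_m | T p.1 p.2 && (val p.1 < val p.2)].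
pose e i := if val i < val (par i) then (i, par i) else (par i, i).
have e_inj : {in [set~ r] &, injective e}.
  move=> a b; rewrite !inE => /parP/andP[_ da] /parP/andP[_ db]; rewrite /e.
  case: ifP => _; case: ifP => _ [] E1 E2 //.
  - by rewrite E2 in da; rewrite -E1 in db; lia.
  - by rewrite E1 in da; rewrite -E2 in db; lia.
have sub_eE : e @: [set~ r] \subset E.
  apply/subsetP=> _ /imsetP[a ar ->]; rewrite !inE in ar *.
  have /andP[Ta da] := parP a ar; rewrite /e; case: ltngtP => /= cmp.
  - by rewrite Tsym Ta cmp.
  - by rewrite Ta cmp.
  - by move/val_inj: cmp da => <-; rewrite ltnn.
have /eqP defE : e @: [set~ r] == E.
  by rewrite eqEcard sub_eE cardT (card_in_imset e_inj) cardsC1 card_ord /=.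
have [lt_ij|lt_ji|eq_ij] := ltngtP (val i) (val j).
- have : (i, j) \in E by rewrite inE /= Tij.
  rewrite -defE => /imsetP[a]; rewrite !inE => ar.
  by rewrite /e; case: ifP => _ [-> ->]; rewrite ar eqxx ?orbT.
- have : (j, i) \in E by rewrite inE /= Tsym Tij.
  rewrite -defE => /imsetP[a]; rewrite !inE => ar.
  by rewrite /e; case: ifP => _ [-> ->]; rewrite ar eqxx ?orbT.
- by rewrite (val_inj eq_ij) Tirr in Tij.
Qed.

(** Here [d] is a depth. Both tops are ancestors of any common node [z], and the climb from [z] to
    the top of [Y] stays in [Y]; being at least as long, it passes through the top of [X]. *)
Lemma tree_tops (m : nat) (T : rel 'I_m) : is_tree T ->
  exists d : 'I_m -> nat, forall X Y x y,
    connected_in T X -> connected_in T Y -> X :&: Y != set0 ->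
    minimal_in d X x -> minimal_in d Y y -> d y <= d x -> x \in Y.
Proof.
case/is_tree_rooted=> r [par0 [d [dlt0 T_par0]]].
(* The root becomes its own parent, so that iterating [par] never increases the depth. *)
pose par i := if i == r then r else par0 i.
have dlt i : i != r -> d (par i) < d i.
  by move=> ir; rewrite /par (negPf ir); apply: dlt0.
have T_par i j : T i j -> (i != r) && (j == par i) || (j != r) && (i == par j).
  by move/T_par0; rewrite /par; case: (i =P r); case: (j =P r).
have dle l i : d (iter l par i) <= d i.
  elim: l => //= l; apply: leq_trans; have [->|/dlt/ltnW//] := eqVneq (iter l par i) r.
  by rewrite /par eqxx.
have itS l i : iter l.+1 par i = iter l par (par i) by rewrite -iterSr.
have climb X x z : connected_in T X -> minimal_in d X x -> z \in X ->
    exists2 l, x = iter l par z & forall i, i <= l -> iter i par z \in X.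
  move=> Xc [Xx x_min]; have [e] := ubnP (d z); elim: e z => // e IHe z lt_ze Xz.
  have [->|zx] := eqVneq z x.
    by exists 0 => // i; rewrite leqn0 => /eqP->.
  have [/andP[zr Xpz]|stop] := boolP ((z != r) && (par z \in X)).
    have [||l def_x in_X] := IHe (par z) => //; first by have := dlt z zr; lia.
    exists l.+1; first by rewrite itS.
    by case=> [//|i]; rewrite itS ltnS; apply: in_X.
  (* Otherwise X cannot leave the subtree of z, so z is the top of X. *)
  have stay y : connect [rel a b | [&& T a b, a \in X & b \in X]] z y ->
      exists l, iter l par y = z.
    case/connectP=> p + ->; elim/last_ind: p => [|p y' IHp]; first by exists 0.
    rewrite rcons_path last_rcons => /andP[/IHp[l def_z] /and3P[Ty Xl Xy']].
    have /orP[/andP[lr /eqP def_y']|/andP[_ /eqP def_l]] := T_par _ _ Ty; last first.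
      by exists l.+1; rewrite itS -def_l.
    case: l => [|l] in def_z; last by exists l; rewrite def_y' -itS.
    by move: stop; rewrite -def_z /= lr -def_y' Xy'.
  have [[|l] def_z] := stay x (Xc z x Xz Xx); first by rewrite -def_z eqxx in zx.
  have := x_min z Xz; have [xr|xr] := eqVneq x r.
    have fix_r i : iter i par r = r by elim: i => //= i ->; rewrite /par eqxx.
    by rewrite -def_z xr fix_r -xr eqxx in zx.
  have := dle l (par x); rewrite -itS def_z; have := dlt x xr; lia.
exists d => X Y x y Xc Yc /set0Pn[z /setIP[Xz Yz]] x_top y_top le_yx.
have [l def_x _] := climb X x z Xc x_top Xz.
have [l' def_y in_Y] := climb Y y z Yc y_top Yz.
have [/in_Y|lt_l'l] := leqP l l'; first by rewrite -def_x.
have {}def_x : x = iter (l - l').-1 par (par y).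
  by rewrite def_x def_y -itS -iterD; congr iter; lia.
have [yr|yr] := eqVneq y r.
  have fix_r i : iter i par r = r by elim: i => //= i ->; rewrite /par eqxx.
  by rewrite def_x yr {2}/par eqxx fix_r -yr; case: y_top.
by have := dle (l - l').-1 (par y); rewrite -def_x; have := dlt y yr; lia.
Qed.

(** Walk along a path inside [U]: consecutive vertices share a bag, and the nodes whose bags contain
    a fixed vertex of [U] are connected. *)
Lemma connected_in_trace (I J : finType) (T : rel I) (R : rel J) (B : I -> {set J})
    (U : {set J}) :
  (forall u, u \in U -> connected_in T [set i | u \in B i]) ->
  (forall u v, R u v -> exists i, (u \in B i) && (v \in B i)) ->
  connected_in R U -> connected_in T [set i | B i :&: U != set0].
Proof.
move=> Bconn Bedge Uconn i j; rewrite !inE => /set0Pn[u /setIP[Bu Uu]] /set0Pn[v /setIP[Bv Uv]].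
set X := [set _ | _].
have sub w a b : w \in U -> w \in B a -> w \in B b ->
    connect [rel a b | [&& T a b, a \in X & b \in X]] a b.
  move=> Uw Ba Bb; have := Bconn w Uw a b; rewrite !inE => /(_ Ba Bb).
  apply: connect_sub => {a b Ba Bb}a b /= /and3P[Tab]; rewrite !inE => Ba Bb.
  apply: connect1; rewrite /= Tab !inE /=.
  by apply/andP; split; apply/set0Pn; exists w; rewrite inE Uw ?Ba ?Bb.
have /connectP[p] := Uconn u v Uu Uv; elim: p u i Bu Uu => [|w p IHp] u i Bu Uu /=.
  by move=> _ def_v; rewrite def_v in Bv; apply: (sub u).
case/andP=> /and3P[/Bedge[a /andP[Bau Baw]] _ Uw] Rp def_v.
exact: connect_trans (sub u i a Uu Bu Bau) (IHp w a Baw Uw Rp def_v).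
Qed.

(* Helly: the top of the deepest trace belongs to all traces. *)
Lemma clique_minor_tw (G : sgraph) (k p : nat) (L : 'I_p -> {set 'I_(vsize G)}) :
  tw_le G k -> (forall i, connected_in (@adj G) (L i)) ->
  (forall i j, i != j -> [disjoint L i & L j]) ->
  (forall i j, exists u v, [/\ u \in L i, v \in L j & (u == v) || adj u v]) ->
  p <= k.+1.
Proof.
case=> m [T [B [/tree_tops[d top_mem] Bv Be Bc cardB]]] Lc Ldisj Ltouch.
case: p => // p in L Lc Ldisj Ltouch *.
pose X i := [set a | B a :&: L i != set0].
have Xc i : connected_in T (X i).
  apply: connected_in_trace Be (Lc i) => u _ a b; rewrite !inE => Ba Bb.
  apply: connect_sub (Bc u a b Ba Bb) => {a b Ba Bb}a b /= /and3P[Tab Ba Bb].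
  by apply: connect1; rewrite /= !inE Tab Ba Bb.
have XX i j : X i :&: X j != set0.
  have [u [v [Lu Lv /orP[/eqP eq_uv|/Be[a /andP[Bau Bav]]]]]] := Ltouch i j.
    have [a Ba] := Bv u; apply/set0Pn; exists a; rewrite !inE.
    by apply/andP; split; apply/set0Pn; exists u; rewrite inE Ba // eq_uv.
  apply/set0Pn; exists a; rewrite !inE.
  by apply/andP; split; apply/set0Pn; [exists u | exists v]; rewrite inE ?Bau ?Bav.
have X0 i : X i != set0 by have := XX i i; rewrite setIid.
have top i : exists x, (x \in X i) && [forall y in X i, d x <= d y].
  have [x [Xx x_min]] := minimal_in_exists d (X0 i).
  by exists x; rewrite Xx; apply/forall_inP.
pose x i := xchoose (top i).
have x_top i : minimal_in d (X i) (x i).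
  by have /andP[Xx /forall_inP] := xchooseP (top i); split.
pose i0 := [arg max_(i > ord0) d (x i)].
have i0P i : d (x i) <= d (x i0) by rewrite /i0; case: arg_maxnP => // j _; apply.
have inX i : x i0 \in X i := top_mem _ _ _ _ (Xc i0) (Xc i) (XX i0 i) (x_top i0) (x_top i) (i0P i).
have w i : exists w, w \in B (x i0) :&: L i by apply/set0Pn; have := inX i; rewrite inE.
have w_inj : injective (fun i => xchoose (w i)).
  move=> i j eq_w; apply: contraTeq isT => /Ldisj/pred0P/(_ (xchoose (w i))) /=.
  have /setIP[_ ->] := xchooseP (w i); rewrite eq_w.
  by have /setIP[_ ->] := xchooseP (w j).
rewrite -[p.+1]card_ord -(card_codom w_inj); apply: leq_trans (cardB (x i0)).
apply/subset_leq_card/subsetP => _ /codomP[i ->].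
by have /setIP[] := xchooseP (w i).
Qed.

(** The code [a * n + u] orders pairs lexicographically; it serves for words, for ranks of vertices
    and for ranks of bags. *)
Lemma divn_lex n a u : u < n -> (a * n + u) %/ n = a.
Proof. by move=> lt_un; rewrite divnMDl ?divn_small ?addn0 //; lia. Qed.

Lemma modn_lex n a u : u < n -> (a * n + u) %% n = u.
Proof. by move=> lt_un; rewrite modnMDl modn_small. Qed.

(** * Elimination orders and greedy colouring *)

(** [K v] stands for the earlier neighbours of [v] in a chordal supergraph: they form a clique, so
    [rk] is a perfect elimination order read backwards. *)
Definition simplicial_order (V : finType) (rk : V -> nat) (K : V -> {set V}) :=
  [/\ injective rk, (forall v u, u \in K v -> rk u < rk v) &
      (forall v u w, u \in K v -> w \in K v -> rk u < rk w -> u \in K w)].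

(** Rank the vertices by the depth of their top bags, ties broken by index, and let [K v] be the
    part of the top bag of [v] ranked before [v]. As [v] is in this bag too, at most [k] places
    remain. *)
Lemma tw_simplicial_order (G : sgraph) (k : nat) : tw_le G k ->
  exists rk K, [/\ @simplicial_order 'I_(vsize G) rk K,
    (forall u v, adj u v -> rk u < rk v -> u \in K v) & (forall v, #|K v| <= k)].
Proof.
case=> m [T [B [/tree_tops[d top_mem] Bv Be Bc cardB]]].
pose X v := [set a | v \in B a].
have Xc v : connected_in T (X v).
  move=> a b; rewrite !inE => Ba Bb.
  apply: connect_sub (Bc v a b Ba Bb) => {a b Ba Bb}a b /= /and3P[Tab Ba Bb].
  by apply: connect1; rewrite /= !inE Tab Ba Bb.
have X0 v : X v != set0 by have [a Ba] := Bv v; apply/set0Pn; exists a; rewrite inE.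
have top v : exists x, (x \in X v) && [forall y in X v, d x <= d y].
  have [x [Xx x_min]] := minimal_in_exists d (X0 v).
  by exists x; rewrite Xx; apply/forall_inP.
pose x v := xchoose (top v).
have x_top v : minimal_in d (X v) (x v).
  by have /andP[Xx /forall_inP] := xchooseP (top v); split.
have Bx v : v \in B (x v) by have [] := x_top v; rewrite inE.
have mem_top u v a : u \in B a -> v \in B a -> d (x u) <= d (x v) -> u \in B (x v).
  move=> Ba Bb le_d; have := top_mem _ _ _ _ (Xc v) (Xc u) _ (x_top v) (x_top u) le_d.
  by rewrite inE; apply; apply/set0Pn; exists a; rewrite !inE Bb.
pose rk (v : 'I_(vsize G)) := d (x v) * vsize G + v.
have rk_d u v : rk u < rk v -> d (x u) <= d (x v).
  by move/ltnW/(leq_div2r (vsize G)); rewrite !divn_lex.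
have rk_inj : injective rk.
  move=> u v eq_rk; apply: val_inj.
  by have /(congr1 (modn^~ (vsize G))) := eq_rk; rewrite /= !modn_lex.
pose K v := [set u in B (x v) | rk u < rk v].
exists rk, K; split.
- split=> // [v u|v u w]; rewrite !inE; first by case/andP.
  by move=> /andP[Bu _] /andP[Bw _] lt_uw; rewrite lt_uw (mem_top u w (x v)) // rk_d.
- by move=> u v /Be[a /andP[Bu Bv']] lt_uv; rewrite inE lt_uv (mem_top u v a) // rk_d.
- move=> v; rewrite -ltnS; apply: leq_trans (cardB (x v)).
  apply/proper_card/properP; split; first by apply/subsetP=> u; rewrite inE => /andP[].
  by exists v; rewrite // inE ltnn andbF.
Qed.

(** Colours are chosen by increasing rank; [K v] blocks at most [k] of the [k.+1] colours. *)
Lemma greedy_colouring (V : finType) (k : nat) (rk : V -> nat) (K : V -> {set V}) :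
  simplicial_order rk K -> (forall v, #|K v| <= k) ->
  exists col : V -> 'I_k.+1, forall v u, u \in K v -> col u != col v.
Proof.
case=> rk_inj K_lt _ cardK.
have [] : exists col : V -> 'I_k.+1, forall v, rk v < (\max_v rk v).+1 ->
    forall u, u \in K v -> col u != col v.
  elim: (\max_v rk v).+1 => [|r [col colP]]; first by exists (fun=> ord0).
  have [/existsP[v /eqP rk_v]|none] := boolP [exists v, rk v == r]; last first.
    exists col => v; rewrite ltnS leq_eqVlt => /predU1P[rk_v|/colP//].
    by case/negP: none; apply/existsP; exists v; apply/eqP.
  have [c colK] : exists c, c \notin col @: K v.
    apply/existsP; apply: contraTT (leq_imset_card col (mem (K v))) => /existsPn all_c.
    rewrite -ltnNge; apply: (@leq_ltn_trans k); first exact: cardK.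
    rewrite -[k.+1 in X in X <= _]card_ord; apply/subset_leq_card/subsetP => c _.
    exact/negbNE/all_c.
  exists (fun u => if u == v then c else col u) => w le_wr u Ku.
  have [def_w|wv] := eqVneq w v.
    subst w; have /negPf-> : u != v.
      by apply: contraTneq (K_lt v u Ku) => ->; rewrite ltnn.
    by apply: contraNneq colK => <-; apply: imset_f.
  have lt_wr : rk w < r.
    by rewrite ltn_neqAle -ltnS le_wr -rk_v (inj_eq rk_inj) wv.
  have /negPf-> : u != v; last exact: colP lt_wr u Ku.
  by apply: contraTneq (K_lt w u Ku) => ->; lia.
by move=> col colP; exists col => v; apply: colP; rewrite ltnS (leq_bigmax v).
Qed.

(** * Tree decompositions built bag by bag *)

(** Each node except [r] gives one edge, and [rk] forbids two nodes to be parents of each other, so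
    these [m.-1] edges are distinct. *)
Lemma parent_is_tree (m : nat) (r : 'I_m) (par : 'I_m -> 'I_m) (rk : 'I_m -> nat) :
  (forall i, i != r -> rk (par i) < rk i) ->
  is_tree [rel i j | (i != r) && (j == par i) || (j != r) && (i == par j)].
Proof.
move=> rk_par; set T := [rel _ _ | _].
have Tsym : symmetric T by move=> i j; rewrite /= orbC.
have Tirr : irreflexive T.
  move=> i; rewrite /= orbb; apply/negbTE; rewrite negb_and.
  by have [//|/rk_par lt_i] := eqVneq i r; apply: contraTneq lt_i => {1}<-; rewrite ltnn.
have to_r i : connect T i r.
  have [e] := ubnP (rk i); elim: e i => // e IHe i lt_ie.
  have [-> //|ir] := eqVneq i r.
  apply: connect_trans (IHe (par i) _); last by have := rk_par i ir; lia.
  by apply: connect1; rewrite /= ir eqxx.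
split=> //; first exact: leq_ltn_trans (ltn_ord r).
  by move=> i j; apply: connect_trans (to_r i) _; rewrite sym_connect_sym.
pose e i := if val i < val (par i) then (i, par i) else (par i, i).
have e_inj : {in [set~ r] &, injective e}.
  move=> a b; rewrite !inE => /rk_par da /rk_par db; rewrite /e.
  case: ifP => _; case: ifP => _ [] E1 E2 //.
  - by rewrite E2 in da; rewrite -E1 in db; lia.
  - by rewrite E1 in da; rewrite -E2 in db; lia.
rewrite -[RHS](_ : #|[set~ r]| = _); last by rewrite cardsC1 card_ord.
rewrite -(card_in_imset e_inj); congr #|pred_of_set _|.
apply/setP=> [[i j]]; rewrite inE /=; apply/idP/imsetP.
  by case/andP=> /orP[]/andP[ir /eqP->] lt_ij; [exists i|exists j];
     rewrite ?inE // /e ?lt_ij // ltnNge ltnW.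
case=> a; rewrite !inE /e => ar; case: ifP => [lt_a|nlt_a] [-> ->].
  by rewrite ar eqxx lt_a.
rewrite ar eqxx orbT /= ltn_neqAle leqNgt nlt_a andbT.
by apply: contraTneq (rk_par a ar) => /val_inj->; rewrite ltnn.
Qed.

(** Bags are added in the order of [rk], and whatever a new bag shares with an earlier one lies in
    its parent. So from every bag containing [v] one climbs, through such bags, to the first of
    them. *)
Lemma tw_le_incremental (G : sgraph) (k : nat) (I : finType) (r : I) (par : I -> I)
    (rk : I -> nat) (B : I -> {set 'I_(vsize G)}) :
  injective rk -> (forall i, i != r -> rk (par i) < rk i) ->
  (forall i j, i != r -> rk j < rk i -> B i :&: B j \subset B (par i)) ->
  (forall v, exists i, v \in B i) ->
  (forall u v, adj u v -> exists i, (u \in B i) && (v \in B i)) ->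
  (forall i, #|B i| <= k.+1) -> tw_le G k.
Proof.
move=> rk_inj rk_par Bsub Bv Be cardB.
pose dec (i : 'I_#|I|) : I := enum_val i.
pose enc (x : I) : 'I_#|I| := enum_rank x.
have encK : cancel enc dec by exact: enum_rankK.
have decK : cancel dec enc by exact: enum_valK.
exists #|I|, [rel i j | (i != enc r) && (j == enc (par (dec i)))
                      || (j != enc r) && (i == enc (par (dec j)))], (fun i => B (dec i)).
split=> //.
- apply: (@parent_is_tree _ (enc r) (fun i => enc (par (dec i))) (fun i => rk (dec i))) => i ir.
  by rewrite encK rk_par //; apply: contraNneq ir => <-; rewrite decK.
- by move=> v; have [i Bi] := Bv v; exists (enc i); rewrite encK.
- by move=> u v /Be[i Bi]; exists (enc i); rewrite encK.
move=> v i j Bi Bj; set T := [rel _ _ | _].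
have Tsym : symmetric T.
  by move=> a b; rewrite /= orbC; congr (_ && _); rewrite andbC.
have Tup a : dec a != r -> v \in B (dec a) -> v \in B (par (dec a)) -> T a (enc (par (dec a))).
  move=> ar Ba Bpa; rewrite /= eqxx encK Ba Bpa /= andbT.
  by rewrite (_ : a != enc r) //; apply: contraNneq ar => ->; rewrite encK.
pose f := [arg min_(x < dec i | v \in B x) rk x].
have [Bf f_min] : v \in B f /\ forall x, v \in B x -> rk f <= rk x.
  by rewrite /f; case: arg_minnP.
have to_f a : v \in B (dec a) -> connect T a (enc f).
  have [e] := ubnP (rk (dec a)); elim: e a => // e IHe a lt_ae Ba.
  have [<-|af] := eqVneq (dec a) f; first by rewrite decK.
  have lt_fa : rk f < rk (dec a).
    by rewrite ltn_neqAle f_min // andbT (inj_eq rk_inj) eq_sym.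
  have [ar|ar] := eqVneq (dec a) r.
    have root_min x : rk r <= rk x.
      have [e'] := ubnP (rk x); elim: e' x => // e' IHe' x lt_x.
      have [->//|/rk_par lt_px] := eqVneq x r.
      by apply: leq_trans (IHe' (par x) _) (ltnW lt_px); lia.
    by have := root_min f; rewrite -ar leqNgt lt_fa.
  have Bpa : v \in B (par (dec a)).
    by apply: (subsetP (Bsub (dec a) f ar lt_fa)); rewrite inE Ba Bf.
  have step : connect T a (enc (par (dec a))) by apply/connect1/Tup.
  apply: connect_trans step _; apply: IHe; rewrite encK //.
  by have := rk_par _ ar; lia.
apply: connect_trans (to_f i Bi) _.
by rewrite sym_connect_sym //; apply: to_f.
Qed.

(** * The layered graphs *)

Section Words.
Variables t n : nat.
Local Notation N := n.*2.+2.

(* The word of length k with base-N value x is the pair (k, x), with x < N ^ k; its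
   longest proper prefix is (k.-1, x %/ N) and its last letter is x %% N. Every label is
   coded by odd letters: as N is even, words ending in odd letters are never
   consecutive in their layer. *)
Definition label (a : nat) : 'I_t.+1 * {set 'I_t.+1} :=
  let default := (if a == 0 then ord0 else ord_max, setT) in
  if odd a then
    if unpickle a./2 : option (nat * 'I_t.+1 * {set 'I_t.+1}) is Some (_, c, C) then (c, C)
    else default
  else default.

Definition colour (x : nat) := (label (x %% N)).1.
Definition links (x : nat) := (label (x %% N)).2.

(* The nearest prefix of (k, x), itself included, of colour c. *)
Fixpoint reg (k x : nat) (c : 'I_t.+1) : option (nat * nat) :=
  if colour x == c then Some (k, x)
  else if k is k'.+1 then reg k' (x %/ N) c else None.

Definition up (z z' : nat * nat) :=
  if z.1 is k.+1 then [exists c in links z.2, reg k (z.2 %/ N) c == Some z'] else false.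

Definition wadj (z z' : nat * nat) :=
  [|| (z.1 == z'.1) && ((z.2 == z'.2.+1) || (z'.2 == z.2.+1)), up z z' | up z' z].

Lemma regS k x c :
  reg k.+1 x c = if colour x == c then Some (k.+1, x) else reg k (x %/ N) c.
Proof. by []. Qed.

Lemma reg_self k x : reg k x (colour x) = Some (k, x).
Proof. by case: k => [|k] /=; rewrite eqxx. Qed.

Lemma reg_layer k x c z : reg k x c = Some z -> z.1 <= k /\ (z.1 = k -> z = (k, x)).
Proof.
elim: k x => [|k IHk] x /=; case: ifP => // _; try by case=> <-.
by move/IHk=> [le_zk _]; split; [exact: leqW | lia].
Qed.

Lemma reg_in_range k x c z : reg k x c = Some z -> z.2 < N ^ z.1 -> x < N ^ k.
Proof.
elim: k x => [|k IHk] x /=; case: ifP => // _; try by case=> <-.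
by move=> /IHk lt_x /lt_x; rewrite ltn_divLR // expnSr.
Qed.

Lemma up_layer z z' : up z z' -> z'.1 < z.1.
Proof.
case: z => [[|k] x] //= /exists_inP[c _ /eqP/reg_layer[]].
by rewrite ltnS.
Qed.

Lemma wadj_sym : symmetric wadj.
Proof.
by move=> z z'; rewrite /wadj eq_sym [(z'.2 == _) || _]orbC [up z z' || _]orbC.
Qed.

Lemma wadj_irr : irreflexive wadj.
Proof.
move=> z; rewrite /wadj !orbb; apply/negbTE; rewrite negb_or.
apply/andP; split; first by lia.
by apply/negP=> /up_layer; rewrite ltnn.
Qed.

(** * Cheapest descending paths *)

Variable S : pred (nat * nat).

Fixpoint path_cost (j k x : nat) : nat :=
  S (k, x) + if j is j'.+1 then
    path_cost j' k.+1 (x * N + [arg min_(a < (ord0 : 'I_N)) path_cost j' k.+1 (x * N + a)])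
  else 0.

(* The least number of elements of S on a path descending from (k, x) to layer n. *)
Definition cost (k x : nat) := path_cost (n - k) k x.

Definition cheap_child (k x : nat) : nat :=
  x * N + [arg min_(a < (ord0 : 'I_N)) path_cost (n - k.+1) k.+1 (x * N + a)].

Lemma cost_cheap_child k x : k < n -> cost k x = S (k, x) + cost k.+1 (cheap_child k x).
Proof. by move=> lt_kn; rewrite /cost -subnSK. Qed.

Lemma cost_last x : cost n x = S (n, x).
Proof. by rewrite /cost subnn /= addn0. Qed.

Lemma cost_child k x a : k < n -> a < N -> cost k x <= S (k, x) + cost k.+1 (x * N + a).
Proof.
move=> lt_kn lt_aN; rewrite cost_cheap_child // leq_add2l /cheap_child /cost.
by case: arg_minnP => // b _ /(_ (Ordinal lt_aN)); apply.
Qed.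

Lemma cheap_child_div k x : cheap_child k x %/ N = x.
Proof. by rewrite divn_lex. Qed.

Lemma descend k x a : k < n -> a < N -> 0 < cost k.+1 (x * N + a) ->
  exists k' x', [/\ k' < n, S (k'.+1, x'), x' %% N = a,
    cost k.+1 (x * N + a) <= cost k'.+1 x' &
    forall c, c != (label a).1 -> reg k' (x' %/ N) c = reg k x c].
Proof.
have [e] := ubnP (n - k); elim: e k x => // e IHe k x lt_e lt_kn lt_aN cost_gt0.
have [Sxa|nSxa] := boolP (S (k.+1, x * N + a)).
  by exists k, (x * N + a); rewrite modn_lex // divn_lex.
have lt_k1n : k.+1 < n.
  rewrite ltn_neqAle lt_kn andbT; apply: contraTneq cost_gt0 => kn.
  by move: nSxa; rewrite kn cost_last => /negPf->.
have := cost_child (x * N + a) lt_k1n lt_aN; rewrite (negPf nSxa) add0n => le_cost.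
have [||//||k' [x' [lt_k'n Sx' x'a le_cost' reg_eq]]] := IHe k.+1 (x * N + a) => //; try lia.
exists k', x'; split=> // [|c ac]; first exact: leq_trans le_cost'.
rewrite reg_eq // regS /colour modn_lex // divn_lex //.
by rewrite eq_sym (negPf ac).
Qed.

(** The word [(l, y)] lies on the cheap path from [(k, x)]. The recursion climbs from the lower end,
    where each step is forced. *)
Fixpoint on_path (l y k x : nat) : bool :=
  ((l, y) == (k, x)) ||
  if l is l'.+1 then (y == cheap_child l' (y %/ N)) && on_path l' (y %/ N) k x else false.

Lemma on_path_layer l y k x : on_path l y k x -> k <= l.
Proof.
elim: l y => [|l IHl] y /=; rewrite xpair_eqE.
  by rewrite orbF => /andP[/eqP<-].
by case/orP=> [/andP[/eqP<-]//|/andP[_ /IHl/leqW]].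
Qed.

Lemma on_path_refl k x : on_path k x k x.
Proof. by case: k => [|k] /=; rewrite eqxx. Qed.

Lemma on_path_same k x y : on_path k y k x -> y = x.
Proof.
case: k => [|k] /=; rewrite xpair_eqE eqxx ?orbF /=; first by move/eqP.
by case/predU1P=> // /andP[_ /on_path_layer]; rewrite ltnn.
Qed.

Lemma on_path_cheap_child l y k x : on_path l y k.+1 (cheap_child k x) -> on_path l y k x.
Proof.
elim: l y => [|l IHl] y //=; case/orP=> [/eqP[-> ->]|/andP[-> /IHl->]]; last by rewrite orbT.
by rewrite cheap_child_div eqxx on_path_refl orbT.
Qed.

Lemma on_path_step l y k x :
  on_path l y k x -> (l, y) = (k, x) \/ k < l /\ on_path l y k.+1 (cheap_child k x).
Proof.
elim: l y => [|l IHl] y /=; first by rewrite orbF => /eqP; left.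
case/predU1P=> [->|/andP[y_next y_on]]; first by left.
right; split; first by rewrite ltnS (on_path_layer y_on).
case: (IHl _ y_on) => [[<- def_y]|[_ ->]]; last by rewrite y_next orbT.
by rewrite -def_y -(eqP y_next) eqxx.
Qed.

(** A word has one prefix of each length, so of two cheap paths through the same word the longer
    contains the start of the shorter. *)
Lemma on_path_chain l y k x k' x' : on_path l y k x -> on_path l y k' x' -> k <= k' ->
  on_path k' x' k x.
Proof.
elim: l y => [|l IHl] y xy x'y le_kk'; have := on_path_layer x'y.
  by rewrite leqn0 => /eqP k'0; move: x'y xy; rewrite k'0 => /on_path_same->.
rewrite leq_eqVlt => /predU1P[k'l|lt_k'l].
  by move: x'y xy; rewrite k'l => /on_path_same->.
have [kl k'l] : (l.+1 == k) = false /\ (l.+1 == k') = false by lia.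
move: xy x'y => /=; rewrite !xpair_eqE kl k'l /=.
by case/andP=> _ xy /andP[_ x'y]; apply: IHl xy x'y le_kk'.
Qed.

Lemma on_path_in_range l y k x : on_path l y k x -> y < N ^ l -> x < N ^ k.
Proof.
elim: l y => [|l IHl] y /=.
  by rewrite orbF => /eqP[<- <-].
case/predU1P=> [[<- <-] //|/andP[_ /IHl lt_x] lt_y]; apply: lt_x.
by rewrite ltn_divLR // -expnSr.
Qed.

(* The least b with [x <= cheap_child k b]. *)
Definition upper (k x : nat) := if x <= cheap_child k (x %/ N) then x %/ N else (x %/ N).+1.

Lemma upper_leq k x : upper k x <= x.
Proof.
rewrite /upper; case: ifP => [_|]; first exact: leq_div.
by case: x => [|x]; rewrite ?div0n // ltn_Pdiv.
Qed.

Lemma cheap_child_lt k x b : b < x %/ N -> cheap_child k b < x.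
Proof.
move=> lt_b; apply: leq_trans (leq_divM x N).
apply: (@leq_trans (b.+1 * N)); last by rewrite leq_mul2r lt_b.
by rewrite /cheap_child mulSnr ltn_add2l ltn_ord.
Qed.

Lemma cheap_child_mono k b b' : b <= b' -> cheap_child k b <= cheap_child k b'.
Proof.
rewrite leq_eqVlt => /predU1P[->//|lt_bb']; apply/ltnW/cheap_child_lt.
by rewrite cheap_child_div.
Qed.

Lemma leq_cheap_child_upper k x : x <= cheap_child k (upper k x).
Proof.
rewrite /upper; case: ifP => // _; apply: leq_trans (leq_addr _ _).
by rewrite ltnW // ltn_ceil.
Qed.

Lemma cheap_child_lt_upper k x b : b < upper k x -> cheap_child k b < x.
Proof.
rewrite /upper; case: (leqP x (cheap_child k (x %/ N))) => [_|lt_x]; first exact: cheap_child_lt.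
by rewrite ltnS leq_eqVlt => /predU1P[->//|]; apply: cheap_child_lt.
Qed.

(** The gap between [x.-1] and [x] lies below the gap before [upper k x]; moving right, the latter
    changes only when a cheap child is passed. *)
Lemma upper_step k x : 0 < x -> upper k x.-1 != upper k x ->
  0 < upper k x /\ x.-1 = cheap_child k (upper k x).-1.
Proof.
move=> x_gt0; rewrite neq_ltn => /orP[lt_u|/cheap_child_lt_upper]; last first.
  by have := leq_cheap_child_upper k x; lia.
split; first exact: leq_ltn_trans lt_u.
have := cheap_child_lt_upper lt_u; have := leq_cheap_child_upper k x.-1.
have : cheap_child k (upper k x.-1) <= cheap_child k (upper k x).-1 by apply: cheap_child_mono; lia.
by have : cheap_child k (upper k x).-1 < x; [apply: cheap_child_lt_upper; lia | lia].
Qed.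

(** The prefix of [x] is one of the two words bordering the enclosing gap. *)
Lemma upper_div k x : x %/ N = (upper k x).-1 \/ x %/ N = upper k x.
Proof. by rewrite /upper; case: ifP => _; [right | left]. Qed.

End Words.

(** * Cheap paths give a tree decomposition *)

Definition word_embedding (t n : nat) (G : sgraph) (f : 'I_(vsize G) -> nat * nat) :=
  [/\ injective f, (forall v, (f v).1 <= n /\ (f v).2 < n.*2.+2 ^ (f v).1) &
      (forall u v, adj u v = wadj t n (f u) (f v))].

Section Decomposition.
Variables (t n : nat) (G : sgraph) (f : 'I_(vsize G) -> nat * nat).
Hypothesis fG : word_embedding t n f.
Local Notation N := n.*2.+2.
Let S : pred (nat * nat) := fun z => z \in codom f.
Local Notation nxt := (cheap_child n S).
Local Notation path := (on_path n S).
Local Notation upp := (upper n S).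

Let f_inj : injective f. Proof. by case: fG. Qed.

Definition in_regs k x v := [exists c : 'I_t.+1, reg n k x c == Some (f v)].

Definition strand k x : {set 'I_(vsize G)} :=
  [set v | path (f v).1 (f v).2 k x || in_regs k x v].

(* The boundary of the region below the gap between x.-1 and x; for x = 0, where
   x.-1 = x, it is the region left of the cheap path from (k, 0). *)
Definition frame k x := strand k x.-1 :|: strand k x.

(** The second part is the frame of the enclosing gap one layer up. *)
Definition bag k x := frame k x :|: (if k is k'.+1 then frame k' (upp k' x) else set0).

Lemma card_path k x : k <= n -> #|[set v | path (f v).1 (f v).2 k x]| <= cost n S k x.
Proof.
have [e] := ubnP (n - k); elim: e k x => // e IHe k x lt_e le_kn.
have card_here : #|[set v | f v == (k, x)]| <= S (k, x).
  case: (boolP (S (k, x))) => [/codomP[v ->]|nS].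
    rewrite (_ : [set _ | _] = [set v]) ?cards1 //.
    by apply/setP=> u; rewrite !inE (inj_eq f_inj).
  rewrite (_ : [set _ | _] = set0) ?cards0 //; apply/setP=> u; rewrite !inE.
  by apply: contraNF nS => /eqP <-; apply: codom_f.
rewrite leq_eqVlt in le_kn; case/predU1P: le_kn => [kn|lt_kn].
  rewrite kn cost_last -kn; apply: leq_trans card_here.
  apply/subset_leq_card/subsetP => v; rewrite !inE => /on_path_step[<-|[lt_kf _]].
    by case: (f v).
  by have [_ /(_ v)[]] := fG; lia.
rewrite cost_cheap_child //; apply: leq_trans (leq_add card_here (IHe k.+1 _ _ lt_kn)); last lia.
apply: leq_trans (leq_card_setU _ _); apply/subset_leq_card/subsetP => v; rewrite !inE.
by case/on_path_step=> [<-|[_ ->]]; [case: (f v) => *; rewrite eqxx | rewrite orbT].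
Qed.

Lemma card_in_regs k x : #|[set v | in_regs k x v]| <= t.+1.
Proof.
pose g v : 'I_t.+1 := odflt ord0 [pick c | reg n k x c == Some (f v)].
have gP v : in_regs k x v -> reg n k x (g v) = Some (f v).
  by case/existsP=> c rc; rewrite /g; case: pickP => [c' /eqP|/(_ c)/=]; rewrite ?rc.
have g_inj : {in [set v | in_regs k x v] &, injective g}.
  move=> u v; rewrite !inE => /gP gu /gP gv eq_g; apply/f_inj.
  by move: gu; rewrite eq_g gv => -[].
by rewrite -(card_in_imset g_inj) -[X in _ <= X]card_ord max_card.
Qed.

(** A bag is a union of at most four strands, each with at most [b] vertices on its path and one
    further vertex per colour. *)
Lemma card_bag b k x : (forall k' x', k' <= n -> cost n S k' x' <= b) -> k <= n ->
  #|bag k x| <= 4 * (b + t.+1).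
Proof.
move=> le_b.
have card_strand k' x' : k' <= n -> #|strand k' x'| <= b + t.+1.
  move=> le_k'n; rewrite (_ : strand k' x' =
    [set v | path (f v).1 (f v).2 k' x'] :|: [set v | in_regs k' x' v]).
    apply: leq_trans (leq_card_setU _ _) (leq_add _ (card_in_regs _ _)).
    exact: leq_trans (card_path _ le_k'n) (le_b _ _ le_k'n).
  by apply/setP=> v; rewrite !inE.
have card_frame k' x' : k' <= n -> #|frame k' x'| <= 2 * (b + t.+1).
  move=> le_k'n; apply: leq_trans (leq_card_setU _ _) _.
  by rewrite mul2n -addnn leq_add ?card_strand.
move=> le_kn; apply: leq_trans (leq_card_setU _ _) _.
rewrite (_ : 4 * _ = 2 * (b + t.+1) + 2 * (b + t.+1)); last lia.
apply: leq_add; first exact: card_frame.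
by case: k => [|k] in le_kn *; rewrite ?cards0 // card_frame // ltnW.
Qed.

(** A gap hangs on its left neighbour if both have the same enclosing gap, and otherwise, being
    leftmost there, on the enclosing gap. Layer 0 forms a path. *)
Definition parent (z : nat * nat) : nat * nat :=
  if z.1 is k.+1 then
    if (0 < z.2) && (upp k z.2.-1 == upp k z.2) then (k.+1, z.2.-1) else (k, upp k z.2)
  else (0, z.2.-1).

Lemma path_frame k x v :
  path (f v).1 (f v).2 k (x %/ N) || in_regs k (x %/ N) v -> v \in frame k (upp k x).
Proof. by rewrite !inE; case: (upper_div n S k x) => <- ->; rewrite ?orbT. Qed.

Lemma mem_frame_parent k x v : v \in frame k (upp k x) -> v \in
  bag (parent (k.+1, x)).1 (parent (k.+1, x)).2.
Proof.
move=> frv; rewrite /parent /=; case: ifP => [/andP[_ /eqP eq_u]|_] /=.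
  by rewrite inE eq_u frv orbT.
by rewrite inE frv.
Qed.

Lemma in_regsS k x v :
  in_regs k.+1 x v -> f v = (k.+1, x) \/ in_regs k (x %/ N) v.
Proof.
case/existsP=> c; rewrite regS; case: ifP => _ /eqP; first by case=> ->; left.
by move=> rc; right; apply/existsP; exists c; rewrite rc.
Qed.

Lemma path_refl k x v : f v = (k, x) -> path (f v).1 (f v).2 k x.
Proof. by move=> ->; apply: on_path_refl. Qed.

Lemma frame_mem k x v : v \in frame k x ->
  exists2 c, c <= x & path (f v).1 (f v).2 k c || in_regs k c v.
Proof. by rewrite !inE => /orP[]; [exists x.-1 => //; exact: leq_pred | exists x]. Qed.

(** Only this is needed of an earlier bag: its strands start no later, lexicographically, than its
    own index. *)
Lemma bag_mem k x v : v \in bag k x -> exists k' x',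
  [/\ k' < k \/ k' = k /\ x' <= x & path (f v).1 (f v).2 k' x' || in_regs k' x' v].
Proof.
rewrite inE => /orP[/frame_mem[c le_cx c_v]|]; first by exists k, c; split=> //; right.
case: k => [|k]; first by rewrite inE.
by case/frame_mem=> c _ c_v; exists k, c; split=> //; left.
Qed.

(** If [x] is a cheap child, its path continues that of its prefix, which borders the enclosing gap.
    Otherwise no earlier strand can meet the path of [x], since a cheap path through [x] must start
    there. *)
Lemma path_bag_frame k x k' x' v : k' < k.+1 \/ k' = k.+1 /\ x' < x ->
  path (f v).1 (f v).2 k.+1 x -> v \in bag k' x' -> v \in frame k (upp k x).
Proof.
move=> lt_z xv /bag_mem[k2 [c [le_z]]].
have [def_x _|nx] := eqVneq x (nxt k (x %/ N)).
  by apply: path_frame; rewrite on_path_cheap_child // -def_x.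
have le_k2 : k2 <= k.+1 by lia.
case/orP=> [cv|/existsP[d /eqP/reg_layer[le_vk2 def_v]]]; last first.
  have := on_path_layer xv => le_kv; have k2E : k2 = (f v).1 by lia.
  have fv1 : (f v).1 = k.+1 by lia.
  have fv2 : (f v).2 = x by move: xv; rewrite fv1 => /on_path_same.
  by move: fv2; rewrite (def_v (esym k2E)) /=; lia.
have := on_path_chain cv xv le_k2; rewrite /= (negPf nx) orbF => /eqP[]; lia.
Qed.

Lemma bag_parent k x k' x' v : (k, x) != (0, 0) -> k' < k \/ k' = k /\ x' < x ->
  v \in bag k x -> v \in bag k' x' -> v \in bag (parent (k, x)).1 (parent (k, x)).2.
Proof.
(* On layer 0 only the word 0 is in range, so the strand of a positive position is empty. *)
case: k => [|k].
  case: x => // x _ _ + _; rewrite /parent /= !inE !orbF.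
  case/orP=> [->|/orP[xv|/existsP[c /eqP rc]]]; first by rewrite orbT.
    by have := on_path_in_range xv; case: fG => _ /(_ v)[_ vN] _ /(_ vN).
  by have := reg_in_range rc; case: fG => _ /(_ v)[_ vN] _ /(_ vN).
move=> _ lt_z; rewrite inE => /orP[|frv _]; last exact: mem_frame_parent.
move=> frv bv; have here : v \in strand k.+1 x ->
    v \in bag (parent (k.+1, x)).1 (parent (k.+1, x)).2.
  rewrite inE => xv; apply: mem_frame_parent.
  case/orP: xv => [xv|/in_regsS[fv|xv]]; first exact: path_bag_frame bv.
    exact: path_bag_frame (path_refl fv) bv.
  by apply: path_frame; rewrite xv orbT.
move: frv; rewrite inE => /orP[|//]; have [x0|x_gt0] := posnP x.
  by rewrite (_ : x.-1 = x) // x0.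
(* If the enclosing gap changes at [x], then [x.-1] is the cheap child of the word left of the new
   gap, whose strand contains that of [x.-1]. *)
rewrite /parent /= x_gt0 /=; case: eqP => [_ xv|/eqP/(upper_step x_gt0)[u_gt0 def_x]] /=.
  by rewrite 2!inE xv orbT.
rewrite inE => xv; rewrite 3!inE.
suff -> : path (f v).1 (f v).2 k (upp k x).-1 || in_regs k (upp k x).-1 v by [].
case/orP: xv => [xv|/in_regsS[fv|]].
- by rewrite on_path_cheap_child // -def_x.
- by rewrite on_path_cheap_child // -def_x path_refl.
- by rewrite {1}def_x cheap_child_div => ->; rewrite orbT.
Qed.

Lemma tw_le_cost b : (forall k x, k <= n -> cost n S k x <= b) -> tw_le G (4 * (b + t.+1)).
Proof.
move=> le_b; have [M0 defM] : exists M0, M0 = N ^ n by exists (N ^ n).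
(* Every layer gets the positions 0 to [N ^ n]; as [upper k x <= x], parents stay in this range. *)
pose M := M0.+1; pose I := ('I_n.+1 * 'I_M)%type.
have le_parent z : z.1 <= n -> z.2 < M -> (parent z).1 < n.+1 /\ (parent z).2 < M.
  case: z => [[|k] x] /=; first by lia.
  by rewrite /parent /=; case: ifP => _ /=; have := upper_leq n S k x; lia.
pose val2 (i : I) : nat * nat := (val i.1, val i.2).
pose par (i : I) : I := (inord (parent (val2 i)).1, inord (parent (val2 i)).2).
have val_par i : val2 (par i) = parent (val2 i).
  have [lt1 lt2] := le_parent (val2 i) (leq_ord i.1) (ltn_ord i.2).
  by rewrite {1}/val2 /= !inordK //; case: (parent _).
have val2_inj : injective val2.
  by move=> [i j] [i' j'] [/val_inj-> /val_inj->].
pose rk (i : I) := i.1 * M + i.2.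
have rk_lt (i j : I) : rk j < rk i -> j.1 < i.1 \/ val j.1 = i.1 /\ j.2 < i.2.
  rewrite /rk => lt_ji; have := leq_div2r M (ltnW lt_ji); rewrite !divn_lex //.
  rewrite leq_eqVlt => /predU1P[eq1|]; last by left.
  by right; split=> //; rewrite eq1 ltn_add2l in lt_ji.
have vN v : (f v).1 < n.+1 /\ (f v).2 < M.
  case: fG => _ /(_ v)[le1 lt2] _; split; first by rewrite ltnS.
  by apply: leq_trans lt2 _; rewrite leqW // defM leq_pexp2l.
have bagP k x : k < n.+1 -> x < M -> exists i : I, val2 i = (k, x).
  by move=> lt1 lt2; exists (Ordinal lt1, Ordinal lt2).
apply: (@tw_le_incremental G _ I (ord0, ord0) par rk (fun i => bag (val2 i).1 (val2 i).2)).
- move=> [i j] [i' j'] eq_rk.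
  have /= := congr1 (divn^~ M) eq_rk; have /= := congr1 (modn^~ M) eq_rk.
  by rewrite /rk /= !divn_lex // !modn_lex // => /val_inj-> /val_inj->.
- move=> i i0; have : val2 i != (0, 0) by rewrite -[(0, 0)]/(val2 (ord0, ord0)) (inj_eq val2_inj).
  rewrite /rk -[nat_of_ord (par i).1]/((val2 (par i)).1) -[nat_of_ord (par i).2]/((val2 (par i)).2).
  rewrite val_par; have [_] := le_parent (val2 i) (leq_ord i.1) (ltn_ord i.2).
  case: i i0 => [[[|k] lt1] [x lt2]] /= _; first by rewrite /parent /= xpair_eqE /=; lia.
  move=> lt_p _; move: lt_p; rewrite /parent /=; case: ifP => [/andP[]|_] /=; first by lia.
  by move=> lt_u; rewrite mulSn; lia.
- move=> i j i0 /rk_lt lt_ij; apply/subsetP=> v; rewrite inE val_par => /andP[vi vj].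
  have i0' : val2 i != (0, 0) by rewrite -[(0, 0)]/(val2 (ord0, ord0)) (inj_eq val2_inj).
  exact: (bag_parent i0' _ vi vj).
- move=> v; have [v1 v2] := vN v; have [i iE] := bagP _ _ v1 v2; exists i; rewrite iE /=.
  by rewrite !inE on_path_refl !orbT.
- have edge u v : wadj t n (f u) (f v) -> (f u).1 <= (f v).1 ->
      (f u).1 = (f v).1 /\ (f v).2 = (f u).2.+1 \/ up t n (f v) (f u) \/
      (f u).1 = (f v).1 /\ (f u).2 = (f v).2.+1.
    case/or3P=> [|/up_layer|->]; last by right; left.
      by case/andP=> /eqP e1 /orP[]/eqP e2; [right; right|left].
    by lia.
  (* The bag of the later endpoint covers the edge: its left neighbour is in its frame, a stored
     ancestor in the enclosing frame. *)
  have cover u v : (f u).1 = (f v).1 /\ (f v).2 = (f u).2.+1 \/ up t n (f v) (f u) ->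
      u \in bag (f v).1 (f v).2 /\ v \in bag (f v).1 (f v).2.
    move=> uv; split; last by rewrite !inE on_path_refl !orbT.
    case: uv => [[e1 e2]|].
      by rewrite !inE e2 /= -e1 on_path_refl.
    case fv : (f v) => [[|k] x] //= /exists_inP[c _ /eqP rc].
    rewrite inE path_frame ?orbT //; apply/orP; right.
    by apply/existsP; exists c; rewrite rc.
  have cover2 u v : wadj t n (f u) (f v) -> (f u).1 <= (f v).1 ->
      exists i, (u \in bag (val2 i).1 (val2 i).2) && (v \in bag (val2 i).1 (val2 i).2).
    move=> uv /(edge u v uv) cases; wlog {cases} uv' : u v uv / 
        (f u).1 = (f v).1 /\ (f v).2 = (f u).2.+1 \/ up t n (f v) (f u).
      move=> wl; case: cases => [c|[c|[c1 c2]]].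
      - by apply: (wl u v uv); left.
      - by apply: (wl u v uv); right.
      by have [||i] := wl v u; [rewrite wadj_sym | left | exists i; rewrite andbC].
    have [v1 v2] := vN v; have [i iE] := bagP _ _ v1 v2.
    by exists i; rewrite iE; apply/andP; apply: cover.
  move=> u v; have [_ _ ->] := fG; have [le_uv uv|/ltnW le_vu uv] := leqP (f u).1 (f v).1.
    exact: cover2.
  by have [|i] := cover2 v u _ le_vu; [rewrite wadj_sym | exists i; rewrite andbC].
- by move=> i; apply: leqW; apply: card_bag => //; rewrite -ltnS ltn_ord.
Qed.
End Decomposition.

(** * Expensive paths give an embedding *)

Section Embedding.
Variables (t : nat) (H : sgraph).
Local Notation V := 'I_(vsize H).
Variables (rk : V -> nat) (K : V -> {set V}) (col : V -> 'I_t.+1).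
Hypothesis orderK : simplicial_order rk K.
Hypothesis adjK : forall u v, adj u v -> rk u < rk v -> u \in K v.
Hypothesis colK : forall v u, u \in K v -> col u != col v.

(** The component [val v], ignored by [label], makes the letters of distinct vertices distinct. *)
Definition digit (v : V) : nat :=
  (pickle (val v, col v, [set col u | u in K v & adj u v])).*2.+1.

Lemma label_digit v : label t (digit v) = (col v, [set col u | u in K v & adj u v]).
Proof. by rewrite /label /digit /= odd_double /= uphalf_double pickleK. Qed.

Lemma digit_inj : injective digit.
Proof.
move=> u v [/double_inj/(pcan_inj pickleK)[/val_inj-> _ _]] //.
Qed.

Variables (n : nat) (S : pred (nat * nat)) (R : nat).
Local Notation N := n.*2.+2.
Hypothesis rkR : forall v, rk v < R.
Hypothesis digitN : forall v, digit v < N.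

(** The invariant of the greedy embedding: the cost left is at least [R - rk v], and the prefixes
    seen from just above the last letter in the colours of [K v] are the images of [K v]. *)
Definition placed (phi : V -> nat * nat) (v : V) : Prop :=
  [/\ 0 < (phi v).1 <= n, S (phi v), (phi v).2 %% N = digit v,
      R <= cost n S (phi v).1 (phi v).2 + rk v &
      forall u, u \in K v -> reg n (phi v).1.-1 ((phi v).2 %/ N) (col u) = Some (phi u)].

Lemma colour_placed phi v : placed phi v -> colour t n (phi v).2 = col v.
Proof. by case=> _ _ + _ _; rewrite /colour => ->; rewrite label_digit. Qed.

Lemma reg_placed phi v u : placed phi v -> u \in K v ->
  reg n (phi v).1 (phi v).2 (col u) = Some (phi u).
Proof.
move=> phi_v Ku; have /= := colour_placed phi_v; case: phi_v => /andP[].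
case: (phi v) => [[|k] x] //= _ _ _ _ _ /(_ u Ku) rv ->.
by rewrite eq_sym (negPf (colK Ku)).
Qed.

Lemma reg_placed_self phi v : placed phi v ->
  reg n (phi v).1 (phi v).2 (col v) = Some (phi v).
Proof.
by move=> /colour_placed <-; rewrite reg_self; case: (phi v).
Qed.

Lemma up_placed phi v z : placed phi v ->
  up t n (phi v) z <-> exists u, [/\ u \in K v, adj u v & z = phi u].
Proof.
case=> /andP[]; case: (phi v) => [[|k] x] //= _ _ _ x_digit _ rv.
rewrite /up /= /links x_digit label_digit; split.
  case/exists_inP=> c /imsetP[u]; rewrite inE => /andP[Ku uv] ->.
  by rewrite rv // => /eqP[<-]; exists u.
case=> u [Ku uv ->]; apply/exists_inP; exists (col u); last by rewrite rv.
by apply: imset_f; rewrite inE Ku.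
Qed.

(** Place the vertices by increasing rank, [v] below the last member of [K v]: this word still sees
    the images of all of [K v]. Then [descend] repeats [digit v], whose colour hides none of
    them. *)
Lemma place_all (k0 x0 : nat) : k0 <= n -> R < cost n S k0 x0 ->
  exists phi, forall v, placed phi v.
Proof.
case: orderK => rk_inj K_lt K_clique le_k0n cost0.
suff : forall r, exists phi, forall v, rk v < r -> placed phi v.
  by case/(_ R) => phi phiP; exists phi => v; apply: phiP.
elim=> [|r [phi phiP]]; first by exists (fun=> (0, 0)).
have [/existsP[v /eqP rk_v]|none] := boolP [exists v, rk v == r]; last first.
  exists phi => v; rewrite ltnS leq_eqVlt => /predU1P[rk_v|/phiP//].
  by case/negP: none; apply/existsP; exists v; apply/eqP.
have K_placed u : u \in K v -> placed phi u by move/K_lt; rewrite rk_v => /phiP.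
have [k [x [le_kn le_R reg_K]]] : exists k x, [/\ k <= n, R < cost n S k x + rk v &
    forall u, u \in K v -> reg n k x (col u) = Some (phi u)].
  have [Kv0|/set0Pn[u0 Ku0]] := eqVneq (K v) set0.
    by exists k0, x0; split=> // [|u]; [lia | rewrite Kv0 inE].
  (* The parent of v in the elimination tree is its last earlier neighbour. *)
  pose p := [arg max_(p > u0 in K v) rk p].
  have [Kp p_max] : p \in K v /\ {in K v, forall u, rk u <= rk p}.
    by rewrite /p; case: arg_maxnP.
  have phi_p := K_placed p Kp; exists (phi p).1, (phi p).2; split.
  - by case: phi_p => /andP[].
  - by case: phi_p => _ _ _ le_R _; have := K_lt v p Kp; lia.
  - move=> u Ku; have [->|up] := eqVneq u p; first exact: reg_placed_self.
    apply: reg_placed => //; apply: (K_clique v u p Ku Kp).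
    by rewrite ltn_neqAle (inj_eq rk_inj) up p_max.
(* A word of layer [n] costs at most 1, while more than [R - rk v >= 1] is left. *)
have lt_kn : k < n.
  rewrite ltn_neqAle le_kn andbT; apply/eqP => kn.
  by move: le_R; rewrite kn cost_last; have := rkR v; case: (S _) => /=; lia.
(* Going to a child loses at most one unit of cost, which the strict inequality [le_R] affords. *)
have cost_R : R <= cost n S k.+1 (x * N + digit v) + rk v.
  by have := cost_child S x lt_kn (digitN v); case: (S _) => /=; lia.
have cost_gt0 : 0 < cost n S k.+1 (x * N + digit v) by have := rkR v; lia.
have [k' [x' [lt_k'n Sx' x'_digit le_cost reg_eq]]] := descend t lt_kn (digitN v) cost_gt0.
exists (fun u => if u == v then (k'.+1, x') else phi u) => w le_wr.
have K_neq u : u \in K w -> u != v by apply: contraTneq => ->; apply/negP => /K_lt; lia.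
rewrite /placed; have [wv|wv] := eqVneq w v.
  split=> //= [||u Ku]; first by rewrite wv.
    by rewrite wv (leq_trans cost_R) // leq_add2r.
  rewrite (negPf (K_neq u Ku)) -[in RHS]reg_K -?wv // reg_eq // label_digit.
  by rewrite -wv colK.
have [|z1 z2 z3 z4 z5] := phiP w.
  by rewrite ltn_neqAle -ltnS le_wr -rk_v (inj_eq rk_inj) wv.
by split=> // u Ku; rewrite (negPf (K_neq u Ku)) z5.
Qed.

(** All images are odd, so no two are consecutive in a layer, and only the stored ancestors give
    edges. *)
Lemma embedding_of_cost (k0 x0 : nat) : k0 <= n -> R < cost n S k0 x0 ->
  exists phi : V -> nat * nat, [/\ injective phi, forall v, S (phi v) &
    forall u v, wadj t n (phi u) (phi v) = adj u v].
Proof.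
move=> le_k0n /(place_all le_k0n)[phi phiP]; exists phi.
have phi_inj : injective phi.
  move=> u v eq_phi; apply: digit_inj.
  by have [_ _ <- _ _] := phiP u; have [_ _ <- _ _] := phiP v; rewrite eq_phi.
have phi_odd v : odd (phi v).2.
  have [_ _ /(congr1 odd) + _ _] := phiP v.
  by rewrite odd_mod /= ?odd_double.
split=> // [v|u v]; first by have [] := phiP v.
have up_adj w w' : up t n (phi w) (phi w') -> adj w w'.
  by case/(up_placed _ (phiP w)) => w0 [_ uw /phi_inj->]; rewrite adj_sym.
have adj_up w w' : adj w w' -> rk w < rk w' -> up t n (phi w') (phi w).
  by move=> ww' lt_w; apply/(up_placed _ (phiP w')); exists w; split=> //; apply: adjK.
apply/idP/idP => [/or3P[|/up_adj//|/up_adj]|uv].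
- by case/andP=> _ /orP[]/eqP eq_x; [have := phi_odd u | have := phi_odd v];
    rewrite eq_x /= phi_odd.
- by rewrite adj_sym.
- rewrite /wadj; case: (ltngtP (rk u) (rk v)) => [/adj_up->|/adj_up->|]; rewrite ?orbT //.
    by rewrite adj_sym.
  by case: orderK => rk_inj _ _ /rk_inj eq_uv; rewrite eq_uv adj_irr in uv.
Qed.

End Embedding.

(** * The class *)

Definition word_class (t : nat) : gclass := fun G => exists n f, @word_embedding t n G f.

Lemma word_class_hereditary t : hereditary (word_class t).
Proof.
move=> G H [n [f [f_inj f_range f_adj]]] [g [g_inj g_adj]]; exists n, (f \o g); split=> /=.
- exact: inj_comp.
- by move=> v; apply: f_range.
- by move=> u v; rewrite -g_adj f_adj.
Qed.

(** * Weak sparsity *)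

Lemma card_up t n (G : sgraph) (f : 'I_(vsize G) -> nat * nat) v : word_embedding t n f ->
  #|[set u | up t n (f v) (f u)]| <= t.+1.
Proof.
move=> fG; case fv : (f v) => [[|k] x] /=.
  by rewrite (_ : [set _ | _] = set0) ?cards0 //; apply/setP=> u; rewrite !inE.
apply: leq_trans (card_in_regs fG k (x %/ n.*2.+2)); apply/subset_leq_card/subsetP=> u.
by rewrite !inE /= => /exists_inP[c _ rc]; apply/existsP; exists c.
Qed.

Lemma card_at t n (G : sgraph) (f : 'I_(vsize G) -> nat * nat) z : word_embedding t n f ->
  #|[set u | f u == z]| <= 1.
Proof.
case=> f_inj _ _; apply/card_le1P => u; rewrite inE => /eqP fu w.
by rewrite !inE -fu (inj_eq f_inj).
Qed.

(* At most two of these vertices lie in the layer of v; the others are joined to v by up. *)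
Lemma card_back_neighbours t n (G : sgraph) (f : 'I_(vsize G) -> nat * nat) v :
  word_embedding t n f -> #|[set u | adj v u & (f u).1 <= (f v).1]| <= t + 3.
Proof.
move=> fG; have := card_at ((f v).1, (f v).2.+1) fG; have := card_at ((f v).1, (f v).2.-1) fG.
have := card_up v fG; set A := [set _ | _]; set B := [set _ | _]; set C := [set _ | _].
move=> cA cB cC; apply: (@leq_trans #|A :|: B :|: C|); last first.
  by have [+ _] := leq_card_setU (A :|: B) C; have [+ _] := leq_card_setU A B; lia.
apply/subset_leq_card/subsetP=> u; rewrite !inE; case: fG => _ _ ->.
case/andP=> /or3P[|->//|/up_layer]; last by lia.
case/andP=> /eqP e1 /orP[]/eqP e2 _; rewrite [f u]surjective_pairing;
  by rewrite !xpair_eqE -e1 e2 /= !eqxx ?orbT.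
Qed.

(** In a [K_{s,s}] with [s = t + 4], a vertex of the deepest layer would have [s] neighbours in
    layers no deeper than its own. *)
Lemma word_class_weakly_sparse t : weakly_sparse (word_class t).
Proof.
exists (t + 4) => G [n [f fG]] [A [B [cardA cardB _ AB]]].
have /set0Pn[a0 Aa0] : A != set0 by rewrite -card_gt0; lia.
pose z := [arg max_(z > a0 in A :|: B) (f z).1].
have [ABz z_max] : z \in A :|: B /\ {in A :|: B, forall u, (f u).1 <= (f z).1}.
  by rewrite /z; case: arg_maxnP; rewrite ?inE ?Aa0.
have := card_back_neighbours z fG; set D := [set _ | _] => le_D.
case/setUP: ABz => [Az|Bz].
  have : B \subset D by apply/subsetP=> b Bb; rewrite inE AB ?z_max // inE Bb orbT.
  by move/subset_leq_card; rewrite cardB => /leq_trans/(_ le_D); lia.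
have : A \subset D by apply/subsetP=> a Aa; rewrite inE adj_sym AB ?z_max // inE Aa.
by move/subset_leq_card; rewrite cardA => /leq_trans/(_ le_D); lia.
Qed.

(** * Unbounded treewidth *)

Lemma word_graph t n : exists (G : sgraph) (f : 'I_(vsize G) -> nat * nat),
  word_embedding t n f /\
  forall k x, k <= n -> x < n.*2.+2 ^ k -> exists v, f v = (k, x).
Proof.
have [M defM] : exists M, M = n.*2.+2 ^ n by exists (n.*2.+2 ^ n).
pose I := {z : 'I_n.+1 * 'I_M | val z.2 < n.*2.+2 ^ val z.1}.
pose w (i : 'I_#|{: I}|) : nat * nat := (val (val (enum_val i)).1, val (val (enum_val i)).2).
have w_sym : symmetric [rel i j | wadj t n (w i) (w j)] by move=> i j; apply: wadj_sym.
have w_irr : irreflexive [rel i j | wadj t n (w i) (w j)] by move=> i; apply: wadj_irr.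
exists (SGraph w_sym w_irr), w; split.
  split=> //= [i j|i]; last by rewrite -ltnS ltn_ord (valP (enum_val i)).
  move=> [/val_inj eq1 /val_inj eq2]; apply/enum_val_inj/val_inj.
  by rewrite [LHS]surjective_pairing eq1 eq2 -surjective_pairing.
move=> k x le_kn lt_x.
have lt_xM : x < M by rewrite defM (leq_trans lt_x) // leq_pexp2l.
pose z : 'I_n.+1 * 'I_M := (Ordinal (le_kn : k < n.+1), Ordinal lt_xM).
have zP : val z.2 < n.*2.+2 ^ val z.1 by [].
by exists (enum_rank (exist _ z zP : I)); rewrite /w enum_rankK.
Qed.

(** Letter 0 links to all colours and has colour 0. The word is [i] letters 0, then [l] letters 2,
    then a last letter 0. *)
Lemma up_first_word t n (i l : nat) : 0 < t -> exists2 x, x < n.+1.*2.+2 ^ (i + l).+1 &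
  up t n.+1 ((i + l).+1, x) (i, 0).
Proof.
set N := n.+1.*2.+2 => t_gt0.
(* Digit 2 has a colour different from that of digit 0, so it hides no word of colour 0. *)
have [y lt_y reg_y] : exists2 y, y < N ^ (i + l) &
    reg n.+1 (i + l) y (ord0 : 'I_t.+1) = Some (i, 0).
  elim: l => [|l [y lt_y reg_y]].
    exists 0; rewrite addn0 ?expn_gt0 //.
    by have := @reg_self t n.+1 i 0; rewrite /colour /label mod0n.
  exists (y * N + 2); first by rewrite (addnS i) expnSr; nia.
  rewrite (addnS i) regS /colour modn_lex // divn_lex // reg_y /label /=.
  by rewrite -val_eqE /= gtn_eqF.
exists (y * N); first by rewrite expnSr; nia.
rewrite /up /= /links modnMl mulnK //; apply/exists_inP; exists ord0; last by rewrite reg_y.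
by rewrite /label /= inE.
Qed.

(* The layers 1, ..., n form a clique minor. *)
Lemma word_class_unbounded t : 0 < t -> ~ bounded_tw (word_class t).
Proof.
(* Treewidth [k] allows at most [k.+1] branch sets, one fewer than the [n] layers used. *)
move=> t_gt0 [k tw_k]; pose n := k.+1.+1; set N := n.*2.+2.
have [G [f [fG f_onto]]] := word_graph t n.
have [f_inj f_range f_adj] := fG.
suff : n <= k.+1 by rewrite ltnn.
apply: (@clique_minor_tw G k n (fun i => [set v | (f v).1 == i.+1])).
- by apply: tw_k; exists n, f.
- move=> i u v; set X := [set _ | _] => Xu Xv.
  pose E := [rel a b | [&& adj a b, a \in X & b \in X]]; rewrite -/(connect E u v).
  have E_sym : connect_sym E.
    apply: sym_connect_sym => a b; rewrite /E /= adj_sym; congr (_ && _); exact: andbC.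
  have [v0 fv0] : exists v, f v = (i.+1, 0) by apply: f_onto; rewrite ?expn_gt0.
  have from0 a : a \in X -> connect E v0 a.
    rewrite inE => /eqP; have [_] := f_range a; case fa : (f a) => [l x] /= lt_x def_l.
    subst l; elim: x a fa lt_x => [|x IHx] a fa lt_x.
      by rewrite (f_inj a v0) ?connect0 // fa fv0.
    have [b fb] : exists b, f b = (i.+1, x) by apply: f_onto => //; apply: ltnW.
    apply: connect_trans (IHx b fb (ltnW lt_x)) (connect1 _).
    by rewrite /E /= !inE f_adj fb fa /wadj /= !eqxx !orbT.
  apply: connect_trans (from0 v Xv).
  by rewrite E_sym from0.
- move=> i j ij; apply/pred0P=> v; rewrite /= !inE; apply: contraNF ij.
  by case/andP=> /eqP-> /eqP[/val_inj->].
- move=> i j; wlog le_ij : i j / i <= j.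
    move=> wl; have [/wl//|/ltnW/wl[u [v [Lu Lv uv]]]] := leqP i j.
    by exists v, u; split=> //; rewrite eq_sym adj_sym.
  have [u fu] : exists v, f v = (i.+1, 0) by apply: f_onto; rewrite ?expn_gt0.
  have [eq_ij|lt_ij] := eqVneq (val i) (val j).
    by exists u, u; rewrite !inE fu -eq_ij /= !eqxx.
  have {}lt_ij : i < j by rewrite ltn_neqAle lt_ij.
  have [x] := @up_first_word t k.+1 i.+1 (j - i.+1) t_gt0.
  rewrite (_ : (i.+1 + (j - i.+1)).+1 = j.+1) => [lt_x up_x|]; last by lia.
  have [v fv] : exists v, f v = (j.+1, x) by apply: f_onto.
  by exists u, v; rewrite !inE f_adj fu fv /wadj up_x !orbT /= !eqxx; split.
Qed.

(** * Bounded treewidth of the [H]-free members *)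

Lemma tw_le_mono (G : sgraph) k k' : k <= k' -> tw_le G k -> tw_le G k'.
Proof.
move=> le_kk' [m [T [B [treeT Bv Be Bc cardB]]]]; exists m, T, B; split=> // i.
exact: leq_trans (cardB i) _.
Qed.

Lemma tw_le_vsize (G : sgraph) k : vsize G <= k -> tw_le G k.
Proof.
move=> le_k; apply: (@tw_le_incremental G k 'I_1 ord0 id val (fun=> setT)) => //.
- exact: val_inj.
- by move=> i; rewrite ord1.
- by move=> v; exists ord0; rewrite inE.
- by move=> u v _; exists ord0; rewrite !inE.
- by move=> i; rewrite cardsT card_ord leqW.
Qed.

Lemma vsize_word_embedding t n D (G : sgraph) (f : 'I_(vsize G) -> nat * nat) :
  word_embedding t n f -> n <= D -> vsize G <= D.+1 * (D.*2.+2 ^ D).+1.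
Proof.
case=> f_inj f_range _ le_nD.
have [M defM] : exists M, M = D.*2.+2 ^ D by exists (D.*2.+2 ^ D).
pose g v : 'I_D.+1 * 'I_M.+1 := (inord (f v).1, inord (f v).2).
have g_inj : injective g.
  have f1 v : (f v).1 < D.+1 by have [le1 _] := f_range v; lia.
  have f2 v : (f v).2 < M.+1.
    have [le1 lt2] := f_range v; rewrite ltnS defM (leq_trans (ltnW lt2)) //.
    apply: (@leq_trans (D.*2.+2 ^ (f v).1)); last by rewrite leq_pexp2l //; lia.
    by case: (f v).1 => // l; rewrite leq_exp2r //; lia.
  move=> u v [/(congr1 val) + /(congr1 val)]; rewrite /= !inordK // => eq1 eq2.
  by apply: f_inj; rewrite [LHS]surjective_pairing eq1 eq2 -surjective_pairing.
by have := leq_card g g_inj; rewrite card_prod !card_ord defM.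
Qed.

Lemma word_class_H_free t (H : sgraph) : tw_le H t ->
  bounded_tw (fun G => word_class t G /\ H_free H G).
Proof.
case/tw_simplicial_order=> rk [K [orderK adjK cardK]].
have [col colK] := greedy_colouring orderK cardK.
pose R := (\max_v rk v).+1; pose D := \max_v digit K col v.
have rkR v : rk v < R by rewrite ltnS (leq_bigmax v).
exists (maxn (4 * (R + t.+1)) (D.+1 * (D.*2.+2 ^ D).+1)) => G [[n [f fG]] freeG].
(* For [n <= D] the alphabet may lack letters needed for [H], but then the order of [G] is bounded
   in terms of [D]. *)
have [lt_Dn|le_nD] := leqP n D.
  by apply: (tw_le_mono (leq_maxr _ _)); apply: tw_le_vsize; apply: vsize_word_embedding fG _.
have digitN v : digit K col v < n.*2.+2.
  by have : digit K col v <= D := leq_bigmax v; lia.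
(* A word costing more than [R] would start an induced copy of [H], so all costs are at most [R]. *)
apply: (tw_le_mono (leq_maxl _ _)); apply: (tw_le_cost fG) => k x le_kn.
rewrite leqNgt; apply/negP => lt_R; apply: freeG.
have [phi [phi_inj phi_S phi_adj]] :=
  embedding_of_cost orderK adjK colK rkR digitN le_kn lt_R.
have f_phi v : f (iinv (phi_S v)) = phi v by apply: f_iinv.
have [_ _ f_adj] := fG.
exists (fun v => iinv (phi_S v)); split=> [u v|u v]; last by rewrite f_adj !f_phi.
by move/(congr1 f); rewrite !f_phi; apply: phi_inj.
Qed.

Theorem theorem1p2 :
  forall t : nat, 0 < t ->
  exists C : gclass,
    [/\ hereditary C, weakly_sparse C, ~ bounded_tw C &
        forall H : sgraph, tw_le H t ->
          bounded_tw (fun G => C G /\ H_free H G)].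
Proof.
move=> t t_gt0; exists (word_class t); split.
- exact: word_class_hereditary.
- exact: word_class_weakly_sparse.
- exact: word_class_unbounded.
- exact: word_class_H_free.
Qed.
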